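(* Let $d\geq 2$ be an integer, let $m$ be a non-negative even integer, let $r\geq 1$ be real, and let $$f(x)=\left(\prod_{i=1}^{m/2}(x-\alpha_i)(x-\alpha_i')\right)\left(\prod_{i=m/2+1}^{d-m/2}(x-\alpha_i)\right)\in\mathbb{C}[x]$$ be a monic polynomial of degree $d$ with complex roots such that $|\alpha_i|=|\alpha_i'|$ for all $i=1,\ldots,m/2$ and $|\alpha_i|\leq r$ for all $i=m/2+1,\ldots,d-m/2$. Then $$M(f)^{2d-3}\geq (2r)^{d(1-d)}\,|\Delta_f|.$$
   Context: For $f=a_0(x-\beta_1)\cdots(x-\beta_d)\in\mathbb{C}[x]$ of degree $d\geq 2$, the Mahler measure is $M(f)=|a_0|\prod_{i=1}^d\max\{1,|\beta_i|\}$ and the discriminant is $\Delta_f=a_0^{2d-2}\prod_{1\leq i<j\leq d}(\beta_i-\beta_j)^2$. *)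

(* Defs.v *)
From mathcomp Require Import all_boot all_order all_algebra.
From mathcomp Require Import complex.
From mathcomp Require Import reals.

Set Implicit Arguments.
Unset Strict Implicit.
Unset Printing Implicit Defensive.

Import Order.TTheory GRing.Theory Num.Theory.
Local Open Scope ring_scope.
Local Open Scope complex_scope.

(* The library norm `|z| on R[i] takes its values in R[i]; [cabs z] is the
   same modulus as an element of R (see [cabsE]). *)
Definition cabs (R : realType) (z : R[i]) : R := Normc.normc z.

Lemma cabsE (R : realType) (z : R[i]) : `|z| = (cabs z)%:C.
Proof. by []. Qed.

(* Listed with multiplicity, in an arbitrary order. *)
Definition croots (R : realType) (f : {poly R[i]}) : seq R[i] :=
  sval (closed_field_poly_normal f).

Lemma crootsE (R : realType) (f : {poly R[i]}) :
  f = lead_coef f *: \prod_(b <- croots f) ('X - b%:P).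
Proof. exact: svalP (closed_field_poly_normal f). Qed.

Lemma perm_croots (R : realType) (a : R[i]) (s : seq R[i]) :
  a != 0 -> perm_eq (croots (a *: \prod_(b <- s) ('X - b%:P))) s.
Proof.
move=> a0; set f := _ *: _; have := crootsE f.
have -> : lead_coef f = a.
  by rewrite lead_coefZ (monicP (monic_prod_XsubC _ _ _)) mulr1.
by move=> /(scalerI a0) /esym /prod_XsubC_eq.
Qed.

Definition mahler (R : realType) (f : {poly R[i]}) : R :=
  cabs (lead_coef f) * \prod_(b <- croots f) Num.max 1 (cabs b).

(* The degree of f is (size f).-1, which is also the length of [croots f]
   when f != 0. *)
Definition disc (R : realType) (f : {poly R[i]}) : R[i] :=
  let d := (size f).-1 in
  lead_coef f ^+ (2 * d - 2) *
  \prod_(i < d) \prod_(j < d | (i < j)%N)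
    ((croots f)`_i - (croots f)`_j) ^+ 2.

(* Main.v *)
(* Write a(b) = max(1,|b|).  For monic f, |disc f| is the product over all
   roots b of the row products prod_{c <> b} |b - c|.  In such a row each factor is
   at most 2 a(b) a(c); one factor a(b) can be saved when some other root c0
   satisfies |b| <= |c0| (then |b - c0| <= 2 a(c0)), and if instead |b| <= r
   then each factor is at most 2 r a(c).  So the d - 1 factors of each row
   contribute at most (2r)^(d-1) a(b)^(d-2) prod_{c <> b} a(c), and
   multiplying the rows gives (2r)^(d(d-1)) M(f)^(2d-3). *)
Require Import Defs.
From mathcomp Require Import all_boot all_order all_algebra.
From mathcomp Require Import complex.
From mathcomp Require Import reals.
From mathcomp Require Import ring lra zify.

Set Implicit Arguments.
Unset Strict Implicit.
Unset Printing Implicit Defensive.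

Import Order.TTheory GRing.Theory Num.Theory.
Local Open Scope ring_scope.

Section Modulus.

Variable R : realType.
Implicit Types (b c : R[i]) (s t : seq R[i]) (r : R).

Lemma cabsM b c : cabs (b * c) = cabs b * cabs c.
Proof. exact: Normc.normcM. Qed.

Lemma cabs1 : cabs (1 : R[i]) = 1.
Proof. exact: Normc.normc1. Qed.

Lemma cabs_ge0 b : 0 <= cabs b.
Proof. by case: b => x y; apply: sqrtr_ge0. Qed.

Lemma cabsX b n : cabs (b ^+ n) = cabs b ^+ n.
Proof.
elim: n => [|n IHn]; first by rewrite !expr0 cabs1.
by rewrite !exprS cabsM IHn.
Qed.

Lemma cabs_prod (I : Type) (q : seq I) (P : pred I) (F : I -> R[i]) :
  cabs (\prod_(i <- q | P i) F i) = \prod_(i <- q | P i) cabs (F i).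
Proof. exact: (big_morph _ cabsM cabs1). Qed.

Lemma cabsBC b c : cabs (b - c) = cabs (c - b).
Proof. by apply: complexI; rewrite -!cabsE distrC. Qed.

Lemma cabsB_le b c : cabs (b - c) <= cabs b + cabs c.
Proof.
have := ler_normB b c.
by rewrite !cabsE -rmorphD /= lecR.
Qed.

Definition max1abs b : R := Num.max 1 (cabs b).

Lemma max1abs_ge1 b : 1 <= max1abs b.
Proof. by rewrite le_max lexx. Qed.

Lemma max1abs_gt0 b : 0 < max1abs b.
Proof. exact: lt_le_trans ltr01 (max1abs_ge1 b). Qed.

Lemma cabs_le_max1abs b : cabs b <= max1abs b.
Proof. by rewrite le_max lexx orbT. Qed.

(** Both [r] and [max1abs c] are at least 1, so each is at most their product, and so is each term
    of [cabs b + cabs c]. Taking [max1abs b] for [r] gives the bound without saving. *)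
Lemma cabsB_le_bounded r b c :
  1 <= r -> cabs b <= r -> cabs (b - c) <= 2 * r * max1abs c.
Proof.
move=> r1 br; have := cabsB_le b c.
have := cabs_le_max1abs c; have := max1abs_ge1 c; nra.
Qed.

Lemma cabsB_le_larger b c :
  cabs b <= cabs c -> cabs (b - c) <= 2 * max1abs c.
Proof. by move=> bc; have := cabsB_le b c; have := cabs_le_max1abs c; lra. Qed.

Lemma cabsB_le_max1abs b c : cabs (b - c) <= 2 * max1abs b * max1abs c.
Proof. exact: cabsB_le_bounded (max1abs_ge1 b) (cabs_le_max1abs b). Qed.

(** Here [t] lists the other roots with multiplicity, so a second copy of [b] counts as dominating
    it. *)
Definition small_or_dominated r b t :=
  cabs b <= r \/ exists2 c, c \in t & cabs b <= cabs c.

Lemma prod_cabsB_le r b t : 1 <= r -> small_or_dominated r b t ->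
  \prod_(c <- t) cabs (b - c) <=
  (2 * r) ^+ size t * max1abs b ^+ (size t).-1 * \prod_(c <- t) max1abs c.
Proof.
move=> r1 [br|[c0 c0t bc0]].
  apply: (@le_trans _ _ (\prod_(c <- t) (2 * r * max1abs c))).
    by apply: ler_prod => c _; rewrite cabs_ge0 cabsB_le_bounded.
  rewrite big_split /= big_const_seq count_predT iter_mulr_1.
  rewrite -mulrA ler_wpM2l ?exprn_ge0 //; first by lra.
  (* For small [b] no power of [max1abs b] arises; it is inserted, being at least 1, so that both
     cases share one bound. *)
  rewrite ler_peMl ?exprn_ege1 ?max1abs_ge1 //.
  by apply: prodr_ge0 => c _; exact/ltW/max1abs_gt0.
(* Only the factor of [c0] avoids [max1abs b]; the remaining [size u] factors cost one each, whence
   the exponent [(size t).-1]. *)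
have pt := perm_to_rem c0t; set u := rem c0 t in pt.
rewrite !(perm_big _ pt) (perm_size pt) !big_cons /=.
have hu : \prod_(c <- u) cabs (b - c) <=
    2 ^+ size u * max1abs b ^+ size u * \prod_(c <- u) max1abs c.
  rewrite -exprMn.
  apply: (@le_trans _ _ (\prod_(c <- u) (2 * max1abs b * max1abs c))).
    by apply: ler_prod => c _; rewrite cabs_ge0 cabsB_le_max1abs.
  by rewrite big_split /= big_const_seq count_predT iter_mulr_1.
have h0 := cabsB_le_larger bc0.
apply: le_trans (_ : (2 * max1abs c0) *
    (2 ^+ size u * max1abs b ^+ size u * \prod_(c <- u) max1abs c) <= _).
  apply: ler_pM => //; first exact: cabs_ge0.
  by apply: prodr_ge0 => c _; exact: cabs_ge0.
rewrite exprMn exprS.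
set x := 2 ^+ _; set y := _ ^+ size u; set p := \prod_(c <- u) _.
(* Both sides share a nonnegative factor, which leaves 1 to be compared with a power of [r]. *)
have -> : 2 * max1abs c0 * (x * y * p) = 1 * (2 * x * (y * (max1abs c0 * p))).
  by rewrite mul1r; ring.
have -> : 2 * x * r ^+ (size u).+1 * y * (max1abs c0 * p) =
  r ^+ (size u).+1 * (2 * x * (y * (max1abs c0 * p))) by ring.
apply: ler_wpM2r; last by rewrite exprn_ege1.
rewrite !mulr_ge0 ?exprn_ge0 ?(ltW (max1abs_gt0 _)) //.
by apply: prodr_ge0 => c _; exact/ltW/max1abs_gt0.
Qed.

(** An index is removed rather than a value, so other copies of a repeated root stay in the list. *)
Lemma perm_nth_others d s (i : 'I_d) : size s = d ->
  perm_eq s (s`_i :: [seq s`_j | j : 'I_d <- rem i (enum 'I_d)]).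
Proof.
move=> sd; have {1}-> : s = [seq s`_j | j : 'I_d <- enum 'I_d].
  rewrite -[LHS](mkseq_nth 0) sd /mkseq -val_enum_ord -map_comp.
  exact: eq_map.
have ei : i \in enum 'I_d by rewrite mem_enum.
exact: (perm_map (fun j : 'I_d => s`_j) (perm_to_rem ei)).
Qed.

Lemma big_others d s (i : 'I_d) (F : R[i] -> R) :
  \prod_(j < d | j != i) F s`_j =
  \prod_(c <- [seq s`_j | j : 'I_d <- rem i (enum 'I_d)]) F c.
Proof. by rewrite big_map rem_filter ?enum_uniq // big_filter big_enum_cond. Qed.

(** Each unordered pair occurs in two rows, and by symmetry contributes a square. *)
Lemma prod_sqr_ltn d (F : 'I_d -> 'I_d -> R) : (forall i j, F i j = F j i) ->
  \prod_(i < d) \prod_(j < d | (i < j)%N) F i j ^+ 2 =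
  \prod_(i < d) \prod_(j < d | j != i) F i j.
Proof.
move=> FC.
have -> : \prod_(i < d) \prod_(j < d | j != i) F i j =
    (\prod_(i < d) \prod_(j < d | (i < j)%N) F i j) *
    (\prod_(i < d) \prod_(j < d | (j < i)%N) F i j).
  rewrite -big_split; apply: eq_bigr => i _ /=.
  rewrite (bigID (fun j : 'I_d => (i < j)%N)) /=; congr (_ * _);
    by apply: eq_bigl => j; rewrite -val_eqE /=; lia.
rewrite [X in _ = _ * X](exchange_big_dep xpredT) //= -big_split.
apply: eq_bigr => i _ /=; rewrite -big_split; apply: eq_bigr => j _ /=.
by rewrite expr2 [F j i]FC.
Qed.

Lemma prod_dist_le d r s : (2 <= d)%N -> 1 <= r -> size s = d ->
    (forall b t, perm_eq s (b :: t) -> small_or_dominated r b t) ->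
  \prod_(i < d) \prod_(j < d | j != i) cabs (s`_i - s`_j) <=
  (2 * r) ^+ (d * d.-1) * (\prod_(b <- s) max1abs b) ^+ (2 * d - 3).
Proof.
move=> d2 r1 sd dom; set P := \prod_(b <- s) _.
have P0 : 0 < P by apply: prodr_gt0 => b _; exact: max1abs_gt0.
pose u (i : 'I_d) := \prod_(j < d | j != i) max1abs s`_j.
have PE : P = \prod_(i < d) max1abs s`_i by rewrite /P (big_nth 0) big_mkord sd.
have Pu (i : 'I_d) : P = max1abs s`_i * u i by rewrite PE (bigD1 i).
have row (i : 'I_d) : \prod_(j < d | j != i) cabs (s`_i - s`_j) <=
    (2 * r) ^+ d.-1 * max1abs s`_i ^+ d.-2 * u i.
  have pi := perm_nth_others i sd; rewrite /u.
  rewrite (big_others s i (fun c => cabs (s`_i - c))) big_others.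
  set t := [seq _ | _ <- _] in pi *.
  have -> : d.-1 = size t by rewrite -sd (perm_size pi).
  exact: prod_cabsB_le (dom _ _ pi).
rewrite -(ler_pM2l P0).
apply: (@le_trans _ _
    (P * \prod_(i < d) ((2 * r) ^+ d.-1 * max1abs s`_i ^+ d.-2 * u i))).
  rewrite ler_pM2l //; apply: ler_prod => i _; rewrite row andbT.
  by apply: prodr_ge0 => j _; exact: cabs_ge0.
have -> : P * \prod_(i < d) ((2 * r) ^+ d.-1 * max1abs s`_i ^+ d.-2 * u i) =
    (2 * r) ^+ (d.-1 * d) * P ^+ d.-2 * P ^+ d.
  rewrite !big_split /= prodr_const card_ord -exprM prodrXl -PE mulrCA.
  congr (_ * _); rewrite {1}PE -big_split /= (eq_bigr (fun=> P)).
    by rewrite prodr_const card_ord.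
  by move=> i _; rewrite -Pu.
rewrite -mulrA -exprD mulrCA -exprS mulnC.
by have -> : (d.-2 + d = (2 * d - 3).+1)%N by lia.
Qed.

End Modulus.

Theorem theorem1p2 (R : realType) (d m : nat) (r : R)
    (alpha alpha' : nat -> R[i]) (f : {poly R[i]})
    (hd : (2 <= d)%N) (hm : ~~ odd m) (hr : 1 <= r)
    (hf : f = (\prod_(1 <= i < (m %/ 2).+1)
                 (('X - (alpha i)%:P) * ('X - (alpha' i)%:P))) *
              (\prod_((m %/ 2).+1 <= i < (d - m %/ 2).+1)
                 ('X - (alpha i)%:P)))
    (hdeg : size f = d.+1)
    (hpair : forall i : nat, (1 <= i <= m %/ 2)%N ->
       cabs (alpha i) = cabs (alpha' i))
    (hle : forall i : nat, (m %/ 2 + 1 <= i <= d - m %/ 2)%N ->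
       cabs (alpha i) <= r) :
  mahler f ^+ (2 * d - 3) >=
    (2 * r) ^ (d%:Z * (1 - d%:Z)) * cabs (disc f).
Proof.
pose k := (m %/ 2)%N.
pose A := [seq alpha i | i <- index_iota 1 k.+1].
pose A' := [seq alpha' i | i <- index_iota 1 k.+1].
pose B := [seq alpha i | i <- index_iota k.+1 (d - k).+1].
have fE : f = 1 *: \prod_(b <- A ++ A' ++ B) ('X - b%:P).
  by rewrite scale1r !big_cat !big_map /= hf big_split mulrA.
have pf : perm_eq (croots f) (A ++ A' ++ B).
  by rewrite fE perm_croots ?oner_neq0.
have lf : lead_coef f = 1.
  by rewrite fE scale1r (monicP (monic_prod_XsubC _ _ _)).
have sf : size (croots f) = d.
  have /(congr1 (fun p : {poly _} => size p)) := crootsE f.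
  by rewrite lf scale1r size_prod_XsubC hdeg => -[].
(* The index [i] is removed from both lists, so the paired roots are separate entries even when
   their values coincide. *)
have partner (i : nat) : i \in index_iota 1 k.+1 -> exists w,
    perm_eq (croots f) (alpha i :: alpha' i :: w).
  move=> hi; exists ([seq alpha j | j <- rem i (index_iota 1 k.+1)] ++
    [seq alpha' j | j <- rem i (index_iota 1 k.+1)] ++ B).
  rewrite (permPl pf) (perm_trans (perm_cat (perm_map alpha (perm_to_rem hi))
    (perm_cat (perm_map alpha' (perm_to_rem hi)) (perm_refl B)))) //=.
  by rewrite perm_cons (perm_catCA _ [:: alpha' i]) /=.
have dom b t : perm_eq (croots f) (b :: t) -> small_or_dominated r b t.
  move=> pb; have : b \in A ++ A' ++ B.
    by rewrite -(perm_mem pf) (perm_mem pb) mem_head.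
  rewrite !mem_cat /A /A' /B => /or3P[bA|bA'|bB].
  - have /mapP[i hi bE] := bA; have [w pw] := partner _ hi.
    rewrite mem_index_iota in hi.
    (* Cancelling [b] from two arrangements of the roots leaves the partner in [t]. *)
    move: pb; rewrite (permPl pw) bE perm_cons => /perm_mem pt.
    right; exists (alpha' i); first by rewrite -pt mem_head.
    by rewrite hpair //; lia.
  - have /mapP[i hi bE] := bA'; have [w pw] := partner _ hi.
    rewrite mem_index_iota in hi.
    move: pb; rewrite (permPl pw) bE (perm_catCA [:: _] [:: _]) perm_cons.
    move=> /perm_mem pt.
    right; exists (alpha i); first by rewrite -pt mem_head.
    by rewrite hpair //; lia.
  - have /mapP[i hi ->] := bB; rewrite mem_index_iota in hi.
    by left; apply: hle; lia.
have -> : mahler f = \prod_(b <- croots f) max1abs b.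
  by rewrite /mahler lf cabs1 mul1r.
have -> : d%:Z * (1 - d%:Z) = - (d * d.-1)%N%:Z by lia.
rewrite -exprnN ler_pdivrMl; last by apply: exprn_gt0; lra.
apply: le_trans (prod_dist_le hd hr sf dom).
(* Equality holds here: for monic [f] the modulus of the discriminant is exactly the product of all
   rows. *)
rewrite le_eqVlt -prod_sqr_ltn => [|i j]; last exact: cabsBC.
apply/orP; left; apply/eqP; rewrite /disc lf expr1n mul1r hdeg /= cabs_prod.
apply: eq_bigr => i _; rewrite cabs_prod; apply: eq_bigr => j _.
exact: cabsX.
Qed.
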